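(* Assume that $H:\mathbb{R}^3\to\mathbb{R}$ satisfies (A0)-(A5) and either (B-i) or (B-ii) (all listed in the context). The set $$E=\{\lambda\in\mathbb{R}:\ \exists\, w \text{ sub-solution of } w_t+H(t,x,w_x)=\lambda \text{ in }\mathbb{R}\times\mathbb{R},\ w \text{ $1$-periodic with respect to } t\}$$ is not empty and bounded from below. Moreover, if $\bar A$ denotes the infimum of $E$, then $$\bar A\ge A_0:=\max_{\alpha=L,R}\left(\min\bar H_\alpha\right),$$ where $\bar H_L,\bar H_R$ are the homogenized Hamiltonians defined in the context.
   Context: Assumptions on $H=H(t,x,p)$. (A0) $H:\mathbb{R}^3\to\mathbb{R}$ is continuous. (A1) $H(t+k,x,p)=H(t,x,p)$ for all $k\in\mathbb{Z}$, $(t,x,p)\in\mathbb{R}^3$. (A2) There is a modulus of continuity $\omega$ such that $H(t,x,p)-H(s,x,p)\le\omega\big(|t-s|(1+\max(H(s,x,p),0))\big)$ for all $t,s,x,p\in\mathbb{R}$. (A3) $\lim_{|q|\to+\infty}H(t,x,q)=+\infty$ uniformly in $(t,x)$. (A4) There is $\rho_0>0$ such that for all $x\in\mathbb{R}\setminus(-\rho_0,\rho_0)$ there is a continuous map $t\mapsto p^0(t,x)$ such that $H(t,x,\cdot)$ is non-increasing on $(-\infty,p^0(t,x))$ and non-decreasing on $(p^0(t,x),+\infty)$. (A5) There are two Hamiltonians $H_L,H_R$ such that $H(t,x+k,p)-H_L(t,x,p)\to0$ as $\mathbb{Z}\ni k\to-\infty$ and $H(t,x+k,p)-H_R(t,x,p)\to0$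 as $\mathbb{Z}\ni k\to+\infty$, uniformly in $(t,x,p)\in[0,1]^2\times\mathbb{R}$, and $H_\alpha(t+k,x+j,p)=H_\alpha(t,x,p)$ for all $k,j\in\mathbb{Z}$, $(t,x,p)\in\mathbb{R}^3$, $\alpha\in\{L,R\}$. (B-i) For each $\alpha=L,R$, $H_\alpha$ does not depend on time and there is $p^0_\alpha$ (independent of $(t,x)$) such that $H_\alpha(x,\cdot)$ is non-increasing on $(-\infty,p^0_\alpha)$ and non-decreasing on $(p^0_\alpha,+\infty)$. (B-ii) For each $\alpha=L,R$ and all $(t,x)$, $p\mapsto H_\alpha(t,x,p)$ is convex. Viscosity solutions. For a locally bounded function $u$, $u^*$ and $u_*$ are its upper and lower semi-continuous envelopes. $u$ is a sub-solution (resp. super-solution) of an equation if, whenever a $C^1$ test function $\varphi$ touches $u^*$ from above (resp. $u_*$ from below) at a point, $\varphi$ satisfies the equation at that point with $\le$ (resp. $\ge$). A solution is both; solutions may be discontinuous. Homogenized Hamiltonians. For $p\in\mathbb{R}$, $\alpha\in\{L,R\}$, $\bar H_\alpha(p)$ is the unique $\lambda\in\mathbb{R}$ for which there is a bounded $\mathbb{Z}^2$-periodic (in $(t,x)$) viscosity solution $v^\alpha$ of $v^\alpha_t+H_\alpha(t,x,p+v^\alpha_x)=\lambda$ in $\mathbb{R}\times\mathbb{R}$; the functions $\bar H_\alpha$ are continuous, coercive and quasi-convex. *)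

(* Defs.v *)
From HB Require Import structures.
From mathcomp Require Export all_boot all_order all_algebra.
From mathcomp Require Export all_classical all_reals all_analysis.

Set Implicit Arguments.
Unset Strict Implicit.
Unset Printing Implicit Defensive.

Import Order.TTheory GRing.Theory Num.Theory.
Import numFieldNormedType.Exports.

Local Open Scope classical_set_scope.
Local Open Scope ring_scope.

(* Points of the (t, x)-plane are pairs z : R * R with z.1 = t and z.2 = x;
   a Hamiltonian is a function of t, x, p in this order. *)

(* The envelopes are extended-real valued; they are finite when u is locally
   bounded. Neighbourhoods of z contain z, so usc_env u z >= u z. *)
Definition usc_env (R : realType) (u : R * R -> R) (z : R * R) : \bar R :=
  limf_esup (EFin \o u) (nbhs z).

Definition lsc_env (R : realType) (u : R * R -> R) (z : R * R) : \bar R :=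
  limf_einf (EFin \o u) (nbhs z).

Definition locally_bounded (R : realType) (u : R * R -> R) : Prop :=
  forall z : R * R, bounded_near u (nbhs z).

Definition dt (R : realType) (phi : R * R -> R) : R * R -> R :=
  'D_((1, 0) : R * R) phi.

Definition dx (R : realType) (phi : R * R -> R) : R * R -> R :=
  'D_((0, 1) : R * R) phi.

Definition C1 (R : realType) (phi : R * R -> R) : Prop :=
  [/\ forall z, differentiable phi z, continuous (dt phi) &
      continuous (dx phi)].

Definition touches_above (R : realType) (u phi : R * R -> R) (z : R * R) :=
  usc_env u z = (phi z)%:E /\
  \forall y \near z, (usc_env u y <= (phi y)%:E)%E.

Definition touches_below (R : realType) (u phi : R * R -> R) (z : R * R) :=
  lsc_env u z = (phi z)%:E /\
  \forall y \near z, ((phi y)%:E <= lsc_env u y)%E.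

(* Viscosity sub- and super-solutions of  u_t + H(t, x, u_x) = lam. *)
Definition subsolution (R : realType) (H : R -> R -> R -> R) (lam : R)
    (u : R * R -> R) : Prop :=
  locally_bounded u /\
  forall phi z, C1 phi -> touches_above u phi z ->
    dt phi z + H z.1 z.2 (dx phi z) <= lam.

Definition supersolution (R : realType) (H : R -> R -> R -> R) (lam : R)
    (u : R * R -> R) : Prop :=
  locally_bounded u /\
  forall phi z, C1 phi -> touches_below u phi z ->
    lam <= dt phi z + H z.1 z.2 (dx phi z).

Definition solution (R : realType) (H : R -> R -> R -> R) (lam : R)
    (u : R * R -> R) : Prop :=
  subsolution H lam u /\ supersolution H lam u.

Definition periodic_t (R : realType) (u : R * R -> R) : Prop :=
  forall t x, u (t + 1, x) = u (t, x).

Definition periodic_tx (R : realType) (u : R * R -> R) : Prop :=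
  forall (k j : int) t x, u (t + k%:~R, x + j%:~R) = u (t, x).

Definition corrector (R : realType) (H : R -> R -> R -> R) (p lam : R)
    (v : R * R -> R) : Prop :=
  [/\ bounded_fun v, periodic_tx v &
      solution (fun t x q => H t x (p + q)) lam v].

Definition homogenized (R : realType) (H : R -> R -> R -> R) (Hbar : R -> R) :=
  forall p, unique (fun lam => exists v, corrector H p lam v) (Hbar p).

(* max (min HbarL) (min HbarR): homogenized Hamiltonians are continuous and
   coercive, so each infimum is attained. *)
Definition lower_flux_limiter (R : realType) (HbarL HbarR : R -> R) : R :=
  Num.max (inf (range HbarL)) (inf (range HbarR)).

Definition quasi_convex_at (R : realType) (p0 : R) (f : R -> R) : Prop :=
  (forall p q, p <= q -> q < p0 -> f q <= f p) /\
  (forall p q, p0 < p -> p <= q -> f p <= f q).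

(* Only the values on [0, +oo[ matter. *)
Definition modulus (R : realType) (omega : R -> R) : Prop :=
  [/\ omega 0 = 0, forall r s, 0 <= r -> r <= s -> omega r <= omega s &
      omega r @[r --> 0^'+] --> (0 : R)].

Definition A0 (R : realType) (H : R -> R -> R -> R) : Prop :=
  continuous (fun y : R * R * R => H y.1.1 y.1.2 y.2).

Definition A1 (R : realType) (H : R -> R -> R -> R) : Prop :=
  forall (k : int) t x p, H (t + k%:~R) x p = H t x p.

Definition A2 (R : realType) (H : R -> R -> R -> R) : Prop :=
  exists2 omega : R -> R, modulus omega &
    forall t s x p,
      H t x p - H s x p <= omega (`|t - s| * (1 + Num.max (H s x p) 0)).

Definition A3 (R : realType) (H : R -> R -> R -> R) : Prop :=
  forall M : R, exists K : R, forall t x q, K <= `|q| -> M <= H t x q.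

Definition A4 (R : realType) (H : R -> R -> R -> R) : Prop :=
  exists2 rho0 : R, 0 < rho0 &
    forall x, ~ (- rho0 < x < rho0) ->
      exists2 p0 : R -> R, continuous p0 &
        forall t, quasi_convex_at (p0 t) (H t x).

Definition A5 (R : realType) (H HL HR : R -> R -> R -> R) : Prop :=
  [/\ forall e : R, 0 < e -> exists K : int, forall k : int, k <= K ->
        forall t x p, 0 <= t <= 1 -> 0 <= x <= 1 ->
          `|H t (x + k%:~R) p - HL t x p| < e,
      forall e : R, 0 < e -> exists K : int, forall k : int, K <= k ->
        forall t x p, 0 <= t <= 1 -> 0 <= x <= 1 ->
          `|H t (x + k%:~R) p - HR t x p| < e,
      forall (k j : int) t x p, HL (t + k%:~R) (x + j%:~R) p = HL t x p &
      forall (k j : int) t x p, HR (t + k%:~R) (x + j%:~R) p = HR t x p].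

Definition Bi (R : realType) (H : R -> R -> R -> R) : Prop :=
  (forall t s x p, H t x p = H s x p) /\
  exists p0 : R, forall t x, quasi_convex_at p0 (H t x).

Definition Bii (R : realType) (H : R -> R -> R -> R) : Prop :=
  forall t x, convex_function [set: R] (H t x).

Definition E_set (R : realType) (H : R -> R -> R -> R) : set R :=
  [set lam | exists w, subsolution H lam w /\ periodic_t w].

(* Main.v *)
Require Import Defs.
From mathcomp Require Import ring lra.

(* Near x = +oo, H is uniformly close to the periodic H_R, so a t-periodic
   sub-solution w of level lam is, on strips of arbitrary width, a sub-solution
   for H_R of level lam + e. Coercivity makes w Lipschitz in x uniformly in t
   there, so for every kappa > 0 there is a parabola q x + kappa x^2, with q
   bounded independently of kappa, touching w from above at some (t1, c) and
   staying above w for |x - c| <= 1 / kappa. Let p be a cluster point of the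
   slopes q as kappa tends to 0 and let v be a corrector for p. For |x - c| <=
   nu / kappa the slope of q x + 2 kappa x^2 is within O(nu) of p, while the
   extra kappa (x - c)^2 reaches nu^2 / kappa, which beats the oscillation of v.
   Hence w - (q x + 2 kappa x^2 + v) is maximal inside that window, and doubling
   variables there yields Hbar_R(p) <= lam + e. The same holds near -oo.

   Neither w_t nor v_t is bounded, so the time variables are doubled with the
   penalisation eta ln (1 + A (t - s)^2): its derivative times |t - s| is at
   most 2 eta, which is what (A2) can absorb, and the resulting bounds on
   |t - s| and on the momenta do not depend on kappa. *)

Set Implicit Arguments.
Unset Strict Implicit.
Unset Printing Implicit Defensive.

Import Order.TTheory GRing.Theory Num.Theory.
Import numFieldNormedType.Exports.
Local Open Scope classical_set_scope.
Local Open Scope ring_scope.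

(** * Upper semi-continuous functions and their maxima on compact sets *)

Definition usc (R : realType) (T : topologicalType) (f : T -> R) : Prop :=
  forall z e, 0 < e -> \forall y \near z, f y < f z + e.

Lemma uscD (R : realType) (T : topologicalType) (f g : T -> R) :
  usc f -> usc g -> usc (fun z => f z + g z).
Proof.
move=> uf ug z e e0; have e2 : 0 < e / 2 by lra.
near=> y.
have : f y < f z + e / 2 by near: y; exact: uf.
have : g y < g z + e / 2 by near: y; exact: ug.
lra.
Unshelve. all: by end_near. Qed.

Lemma continuous_usc (R : realType) (T : topologicalType) (f : T -> R) :
  continuous f -> usc f.
Proof.
move=> cf z e e0; have /cvgrPdist_lt/(_ e e0) := cf z.
by apply: filterS => y; rewrite ltr_distlC => /andP[_].
Qed.

Lemma usc_comp (R : realType) (S T : topologicalType) (f : T -> R) (g : S -> T) :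
  usc f -> continuous g -> usc (f \o g).
Proof. by move=> uf cg z e e0; exact: (cg z _ (uf (g z) e e0)). Qed.

(** The superlevel sets of [f] in [K] are nested, hence generate a filter. If no maximum existed,
    near every [x] the values of [f] would stay below some [f y]; compactness in its covering form
    would then give one [y] in [K] with [f < f y] on all of [K], including at [y]. *)
Lemma usc_max (R : realType) (T : topologicalType) (f : T -> R) (K : set T) :
  compact K -> K !=set0 -> usc f ->
  exists2 c, K c & forall y, K y -> f y <= f c.
Proof.
move=> cK [k0 Kk0] uf; apply: contrapT => nomax.
have big y : K y -> exists2 y', K y' & f y < f y'.
  move=> Ky; apply: contrapT => h; apply: nomax; exists y => // z Kz.
  by rewrite leNgt; apply/negP => fyz; apply: h; exists z.
pose F := filter_from K (fun y => [set i | K i /\ f y <= f i]).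
have FF : Filter F.
  apply: filter_from_filter; first by exists k0.
  move=> y z Ky Kz; have [yz|/ltW zy] := leP (f y) (f z).
    by exists z => // i [Ki] zi; split; split=> //; exact: le_trans yz zi.
  by exists y => // i [Ki] yi; split; split=> //; exact: le_trans zy yi.
move/compact_near_coveringP : cK => /(_ _ _ (fun i x => f x < f i) FF).
case=> [x /big[y Ky fxy]|y Ky sub]; last first.
  by have := sub y (conj Ky (lexx _)) y Ky; rewrite /= ltxx.
have fxy0 : 0 < f y - f x by lra.
exists ([set x' | f x' < f y], [set i | K i /\ f y <= f i]) => /=.
  split; last by exists y.
  by apply: filterS (uf x _ fxy0) => x' /=; rewrite addrC subrK.
by case=> x' i /= [fx' [_]]; exact: lt_le_trans.
Qed.

(** * Envelopes and quadratic test functions *)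

Lemma usc_env_le (R : realType) (u : R * R -> R) z (c : \bar R) :
  (\forall y \near z, ((u y)%:E <= c)%E) -> (usc_env u z <= c)%E.
Proof.
move=> uc; rewrite /usc_env limf_esupE; apply: ge_ereal_inf.
exists (ereal_sup ((EFin \o u) @` [set y | ((u y)%:E <= c)%E])).
  by exists [set y | ((u y)%:E <= c)%E].
by apply: ge_ereal_sup => _ [y /= yc <-].
Qed.

Lemma usc_env_lt (R : realType) (u : R * R -> R) z (c : \bar R) :
  (usc_env u z < c)%E ->
  exists A : set (R * R), [/\ nbhs z A, (ereal_sup ((EFin \o u) @` A) < c)%E &
    forall y, A y -> ((u y)%:E < c)%E].
Proof.
rewrite /usc_env limf_esupE => /ereal_inf_lt[_ [A zA <-] supAc].
exists A; split=> // y Ay; apply: le_lt_trans supAc.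
by apply: ereal_sup_ubound; exists y.
Qed.

Lemma usc_env_near (R : realType) (u : R * R -> R) z (c : \bar R) :
  (usc_env u z < c)%E -> \forall y \near z, (usc_env u y < c)%E.
Proof.
move=> /usc_env_lt[A [/nbhs_interior zA supAc _]].
apply: filterS zA => y yA; apply: le_lt_trans supAc.
apply: usc_env_le; apply: filterS yA => y' Ay'.
by apply: ereal_sup_ubound; exists y'.
Qed.

Lemma le_usc_env (R : realType) (u : R * R -> R) z : ((u z)%:E <= usc_env u z)%E.
Proof.
rewrite leNgt; apply/negP => /usc_env_lt[A [/nbhs_singleton Az _]].
by move=> /(_ z Az); rewrite ltxx.
Qed.

Lemma usc_env_cst (R : realType) (k : R) z : usc_env (fun=> k) z = k%:E.
Proof.
apply/eqP; rewrite eq_le (le_usc_env (fun=> k)) andbT.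
by apply: usc_env_le; near=> y.
Unshelve. all: by end_near. Qed.

(** [fine] sends infinite values to 0; for locally bounded [u] nothing is lost, by [envE]. *)
Definition env (R : realType) (u : R * R -> R) z := fine (usc_env u z).

Section Envelope.
Variables (R : realType) (u : R * R -> R).

Lemma envE z : locally_bounded u -> usc_env u z = (env u z)%:E.
Proof.
move=> /(_ z) /ex_bound[M uM]; rewrite /env fineK// fin_numElt.
rewrite (lt_le_trans (ltNyr _) (le_usc_env u z)) /=.
apply: le_lt_trans (ltry M); apply: usc_env_le; apply: filterS uM => y /=.
by rewrite lee_fin; exact/le_trans/ler_norm.
Qed.

Lemma env_usc : locally_bounded u -> usc (env u).
Proof.
move=> ub z e e0; have : (usc_env u z < (env u z + e)%:E)%E.
  by rewrite envE// lte_fin ltrDl.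
by move=> /usc_env_near; apply: filterS => y; rewrite envE// lte_fin.
Qed.

Lemma env_le z M : locally_bounded u -> (forall y, u y <= M) -> env u z <= M.
Proof.
move=> ub uM; rewrite -lee_fin -envE//.
by apply: usc_env_le; near=> y; rewrite lee_fin.
Unshelve. all: by end_near. Qed.

Lemma le_env z : locally_bounded u -> u z <= env u z.
Proof. by move=> ub; rewrite -lee_fin -envE// le_usc_env. Qed.

Lemma env_shift h : locally_bounded u -> (forall z, u (z + h) = u z) ->
  forall z, env u (z + h) = env u z.
Proof.
move=> ub uh.
have le k z : (forall z, u (z + k) = u z) -> env u (z + k) <= env u z.
  move=> uk; apply/ler_addgt0Pr => e e0.
  have : (usc_env u z < (env u z + e)%:E)%E by rewrite envE// lte_fin ltrDl.
  move=> /usc_env_lt[A [zA _ Ac]]; rewrite -lee_fin -envE//.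
  apply: usc_env_le; rewrite (near_shift z) /=.
  apply: filterS zA => y /Ac /ltW; rewrite -{1}uk /shift /=.
  by rewrite [z + k]addrC addrK.
move=> z; apply/eqP; rewrite eq_le le//=.
have /(le (- h)) : forall z, u (z - h) = u z by move=> y; rewrite -[in RHS](subrK h y) uh.
by move=> /(_ (z + h)); rewrite addrK.
Qed.

End Envelope.

(** The only test functions used: separated quadratics, with first-order part [(a, b)] at
    [(t0, x0)]. *)
Definition quad (R : realType) (k a A b B t0 x0 : R) (z : R * R) : R :=
  k + a * (z.1 - t0) + A * (z.1 - t0) ^+ 2 +
    b * (z.2 - x0) + B * (z.2 - x0) ^+ 2.

Lemma quad_is_diff (R : realType) (k a A b B t0 x0 : R) (z : R * R) :
  is_diff z (quad k a A b B t0 x0)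
    (fun h => (a + 2 * A * (z.1 - t0)) * h.1 + (b + 2 * B * (z.2 - x0)) * h.2).
Proof.
have d1 : is_diff z (fst : R * R -> R) fst.
  apply: DiffDef; first by apply: linear_differentiable => ?; exact: cvg_fst.
  by rewrite diff_lin// => ?; exact: cvg_fst.
have d2 : is_diff z (snd : R * R -> R) snd.
  apply: DiffDef; first by apply: linear_differentiable => ?; exact: cvg_snd.
  by rewrite diff_lin// => ?; exact: cvg_snd.
rewrite (_ : quad _ _ _ _ _ _ _ = cst k + cst a * (fst - cst t0) +
  cst A * (fst - cst t0) ^+ 2 + cst b * (snd - cst x0) +
  cst B * (snd - cst x0) ^+ 2); last by apply/funext => y.
apply: is_diff_eq; apply/funext => h /=.
rewrite !(fctE, scalrfctE) /= /GRing.scale /= /cst.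
have -> : (0 : R * R -> R) h = 0 by []; ring.
Qed.

Lemma quad_dt (R : realType) (k a A b B t0 x0 : R) z :
  dt (quad k a A b B t0 x0) z = a + 2 * A * (z.1 - t0).
Proof.
have h := quad_is_diff k a A b B t0 x0 z.
by rewrite /dt deriveE// diff_val /= mulr1 mulr0 addr0.
Qed.

Lemma quad_dx (R : realType) (k a A b B t0 x0 : R) z :
  dx (quad k a A b B t0 x0) z = b + 2 * B * (z.2 - x0).
Proof.
have h := quad_is_diff k a A b B t0 x0 z.
by rewrite /dx deriveE// diff_val /= mulr1 mulr0 add0r.
Qed.

Lemma quad_C1 (R : realType) (k a A b B t0 x0 : R) : C1 (quad k a A b B t0 x0).
Proof.
split.
- by move=> z; have h := quad_is_diff k a A b B t0 x0 z; exact: ex_diff.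
- rewrite (_ : dt _ = fun z => a + 2 * A * (z.1 - t0)); last first.
    by apply/funext => z; exact: quad_dt.
  move=> z; apply: cvgD; first exact: cvg_cst.
  by apply: cvgMr; apply: cvgB; [exact: cvg_fst|exact: cvg_cst].
- rewrite (_ : dx _ = fun z => b + 2 * B * (z.2 - x0)); last first.
    by apply/funext => z; exact: quad_dx.
  move=> z; apply: cvgD; first exact: cvg_cst.
  by apply: cvgMr; apply: cvgB; [exact: cvg_snd|exact: cvg_cst].
Qed.

(* Only touching within a strip |x - x0| < r is asked for: the maxima produced
   below are global in t. A super-solution v is handled through the superjets
   of the upper envelope of - v. *)
Definition superjet (R : realType) (U : R * R -> R) (t0 x0 a b : R) : Prop :=
  exists A B r : R, 0 < r /\ forall t x : R, `|x - x0| < r ->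
    U (t, x) <= quad (U (t0, x0)) a A b B t0 x0 (t, x).

Lemma superjet_touches (R : realType) (u : R * R -> R) t0 x0 a b :
  locally_bounded u -> superjet (env u) t0 x0 a b ->
  exists A B, touches_above u (quad (env u (t0, x0)) a A b B t0 x0) (t0, x0).
Proof.
move=> ub [A [B [r [r0 jet]]]]; exists A, B; split.
  by rewrite envE// /quad /= !subrr expr0n /= !mulr0 !addr0.
exists (setT, [set x | `|x - x0| < r]) => /=.
  split; first exact: filterT.
  by exists r => // y /=; rewrite distrC.
by move=> [t x] /= [_ xr]; rewrite envE// lee_fin; exact: jet.
Qed.

Lemma subsolution_superjet (R : realType) (H : R -> R -> R -> R) lam
    (u : R * R -> R) t x a b :
  subsolution H lam u -> superjet (env u) t x a b -> a + H t x b <= lam.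
Proof.
move=> [ub sub] /(superjet_touches ub)[A [B tch]].
have := sub _ _ (quad_C1 _ _ _ _ _ _ _) tch.
by rewrite quad_dt quad_dx /= !subrr !mulr0 !addr0.
Qed.

Lemma locally_boundedN (R : realType) (u : R * R -> R) :
  locally_bounded u -> locally_bounded (fun z => - u z).
Proof.
move=> ub z; have /ex_bound[M uM] := ub z; apply/ex_bound; exists M.
by apply: filterS uM => y /=; rewrite normrN.
Qed.

Lemma lsc_envE (R : realType) (v : R * R -> R) z :
  lsc_env v z = (- usc_env (fun z => - v z)%R z)%E.
Proof. by []. Qed.

(** Negation swaps the two envelopes and the two ways of touching, and flips the sign of every
    coefficient of the quadratic. *)
Lemma supersolution_superjet (R : realType) (H : R -> R -> R -> R) lam
    (v : R * R -> R) t x a b :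
  supersolution H lam v -> superjet (env (fun z => - v z)) t x a b ->
  lam <= - a + H t x (- b).
Proof.
move=> [vb super] /(superjet_touches (locally_boundedN vb))[A [B [tch near_le]]].
set k := env _ _ in tch near_le.
have Nquad z : quad (- k) (- a) (- A) (- b) (- B) t x z = - quad k a A b B t x z.
  by rewrite /quad; ring.
have := super (quad (- k) (- a) (- A) (- b) (- B) t x) (t, x) (quad_C1 _ _ _ _ _ _ _).
rewrite quad_dt quad_dx /= !subrr !mulr0 !addr0; apply; split.
  by rewrite lsc_envE tch Nquad.
by apply: filterS near_le => y; rewrite lsc_envE Nquad EFinN leeN2.
Qed.

(** * Parabolas touching a periodic sub-solution from above *)

Lemma periodic_int (R : realType) (T : Type) (f : R -> T) :
  (forall x, f (x + 1) = f x) -> forall (k : int) x, f (x + k%:~R) = f x.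
Proof.
move=> f1 k; have fn (n : nat) x : f (x + n%:R) = f x.
  elim: n x => [|n IHn] x; first by rewrite addr0.
  by rewrite -addn1 natrD addrA f1.
case: k => [n|n] x; first by rewrite -pmulrn.
by rewrite NegzE mulrNz -[in RHS](subrK n.+1%:R x) fn.
Qed.

Lemma periodic_unit (R : realType) (x : R) :
  exists2 k : int, 0 <= x + k%:~R & x + k%:~R <= 1.
Proof.
exists (- Num.floor x); rewrite mulrNz; first by rewrite subr_ge0 ge_floor.
by rewrite lerBlDl; have /ltW := floorD1_gt x; rewrite intrD.
Qed.

Section Strip.
Variables (R : realType) (U : R * R -> R).
Hypotheses (uscU : usc U) (perU : forall t x : R, U (t + 1, x) = U (t, x)).

(** [psi] ignores [t], so time periodicity reduces the unbounded strip to the compact set [0, 1] x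
    [x0 - L, x0 + L]. *)
Lemma strip_max (psi : R -> R) (x0 L : R) : continuous psi -> 0 <= L ->
  exists t1 x1 : R, `|x1 - x0| <= L /\
    forall t x : R, `|x - x0| <= L -> U (t, x) - psi x <= U (t1, x1) - psi x1.
Proof.
move=> cpsi L0.
have uf : usc (fun z : R * R => U z + - psi z.2).
  apply: uscD => //; apply: continuous_usc => z.
  by apply: cvgN; apply: (cvg_comp _ _ cvg_snd); exact: cpsi.
pose K : set (R * R) := `[0, 1] `*` `[x0 - L, x0 + L].
have cK : compact K.
  by apply: compact_setX; exact: segment_compact.
have K0 : K !=set0.
  by exists (0, x0); split; rewrite /= in_itv /=; lra.
have [[t1 x1] [/= _]] := usc_max cK K0 uf.
rewrite in_itv /= -ler_distlC => x1L tx1.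
exists t1, x1; split; first by rewrite distrC.
move=> t x xL; have [k k0 k1] := periodic_unit t.
have := tx1 (t + k%:~R, x); rewrite /= (periodic_int (f := fun t => U (t, x)))//.
by apply; split; rewrite /= in_itv /= ?k0// -ler_distlC distrC.
Qed.

Variables (G : R -> R -> R -> R) (C lam : R).
Hypotheses (Gcoer : forall t x q : R, C <= `|q| -> lam < G t x q).

Section Lipschitz.
Variables (c L S b0 : R).
Hypotheses
  (sub : forall t x a b : R, `|x - c| < L + 1 -> superjet U t x a b ->
     a + G t x b <= lam)
  (US : forall t x : R, `|x - c| <= L + 1 -> U (t, x) <= S)
  (Uc : forall t : R, U (t, c) <= b0).

(* The kink of C |x - x0| is avoided: away from x0 it is touched from above by
   the parabola C ((x - x0)^2 / (2 d) + d / 2) with d = |x1 - x0|. *)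
Lemma lipschitz_step (x0 b A : R) : 0 < C -> `|x0 - c| <= L ->
  (forall t : R, U (t, x0) <= b) -> 0 <= A -> S < b + A ->
  forall t x : R, `|x - x0| <= 1 ->
    U (t, x) <= b + C * `|x - x0| + A * (x - x0) ^+ 2.
Proof.
move=> C0 x0L Ub A0 SbA.
pose psi (x : R) : R := C * `|x - x0| + A * (x - x0) ^+ 2.
have cpsi : continuous psi.
  have cB : continuous (fun x : R => x - x0).
    by move=> x; apply: cvgB; [exact: cvg_id|exact: cvg_cst].
  move=> x; apply: cvgD; apply: cvgMr; first by apply: cvg_norm; exact: cB.
  by rewrite expr2; apply: cvgM; exact: cB.
have [t1 [x1 [x1L max1]]] := strip_max x0 cpsi ler01.
suff le1 : U (t1, x1) - psi x1 <= b.
  by move=> t x /(max1 t x); rewrite /psi in le1 *; lra.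
rewrite leNgt; apply/negP => lt1.
pose d : R := `|x1 - x0|.
have d2 : (x1 - x0) ^+ 2 = d ^+ 2 by rewrite /d real_normK ?num_real.
have d0 : 0 < d.
  rewrite normr_gt0 subr_eq0; apply/eqP => e; move: lt1.
  by rewrite e /psi subrr normr0 expr0n /= !mulr0 addr0 subr0 ltNge Ub.
have d1 : d < 1.
  (* At distance 1 the term [A] alone lifts the barrier above [S], so the maximum is not on the
     boundary of the strip. *)
  rewrite lt_neqAle x1L andbT; apply/eqP => e.
  have US1 : U (t1, x1) <= S.
    by apply: US; have := ler_distD x0 x1 c; rewrite -/d; lra.
  move: lt1; rewrite /psi -/d d2 e expr1n => lt1.
  suff : b < b by rewrite ltxx.
  lra.
pose B := C / (2 * d) + A.
have : 0 + G t1 x1 (2 * B * (x1 - x0)) <= lam.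
  apply: sub; first by have := ler_distD x0 x1 c; rewrite -/d; lra.
  exists 0, B, (1 - d); split; first by lra.
  move=> t x xr; have xL : `|x - x0| <= 1.
    by have := ler_distD x1 x x0; rewrite -/d; lra.
  have := max1 t x xL; rewrite /quad /psi -/d /=.
  set y : R := `|x - x0|.
  have y2 : (x - x0) ^+ 2 = y ^+ 2 by rewrite /y real_normK ?num_real.
  have Cy : C * y <= C / (2 * d) * (y ^+ 2 + d ^+ 2).
    rewrite -subr_ge0.
    have -> : C / (2 * d) * (y ^+ 2 + d ^+ 2) - C * y =
      C / (2 * d) * (y - d) ^+ 2 by field; lra.
    by rewrite mulr_ge0 ?sqr_ge0// divr_ge0; lra.
  have Cd : C * d = 2 * (C / (2 * d) * d ^+ 2) by field; lra.
  have -> : 2 * B * (x1 - x0) * (x - x1) = B * (y ^+ 2 - d ^+ 2) - B * (x - x1) ^+ 2.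
    by rewrite -y2 -d2; ring.
  have -> : B * (y ^+ 2 - d ^+ 2) = C / (2 * d) * (y ^+ 2 + d ^+ 2) -
      2 * (C / (2 * d) * d ^+ 2) + A * y ^+ 2 - A * d ^+ 2.
    by rewrite /B; field; lra.
  by rewrite y2 d2; lra.
(* The touching slope has size [C + 2 * A * d], at least [C], which coercivity forbids. *)
rewrite add0r leNgt Gcoer// !normrM -/d.
have B0 : 0 < B by rewrite ltr_wpDr// divr_gt0; lra.
rewrite !gtr0_norm//; have -> : 2 * B * d = C + 2 * A * d.
  by rewrite /B; field; lra.
by nra.
Qed.

(** Going from [c] to [x] in [n + 1] equal applications of [lipschitz_step] costs [C * |y|] plus
    [A * y ^+ 2 / (n + 1)] in total, and the second term vanishes as [n] grows. One [A] serves every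
    step because the successive bounds only increase. *)
Lemma lipschitz_bound (t x : R) : 0 < C -> `|x - c| <= L -> U (t, x) <= b0 + C * `|x - c|.
Proof.
move=> C0 xL; pose y := x - c; pose A := `|S - b0| + 1.
have A1 : 1 <= A by rewrite lerDr.
have SA : S < b0 + A by have := ler_norm (S - b0); rewrite /A; lra.
have main (n : nat) : `|y| <= n.+1%:R ->
    U (t, x) <= b0 + C * `|y| + A * y ^+ 2 / n.+1%:R.
  move=> yn; pose N : R := n.+1%:R; have N0 : 0 < N by rewrite ltr0n.
  pose h := y / N.
  have h1 : `|h| <= 1 by rewrite normrM normfV (gtr0_norm N0) ler_pdivrMr ?mul1r.
  have step (i : nat) : (i <= n.+1)%N -> forall s,
      U (s, c + i%:R * h) <= b0 + i%:R * (C * `|h| + A * h ^+ 2).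
    elim: i => [_ s|i IHi iN s]; first by rewrite !mul0r !addr0.
    have cont : 0 <= C * `|h| + A * h ^+ 2.
      by rewrite addr_ge0// mulr_ge0 ?sqr_ge0//; lra.
    have i0 : (0 : R) <= i%:R by rewrite ler0n.
    have ihL : `|c + i%:R * h - c| <= L.
      rewrite addrAC subrr add0r (le_trans _ xL)// -/y /h !normrM normfV.
      rewrite (gtr0_norm N0) ger0_norm// mulrCA ler_piMr//.
      by rewrite ler_pdivrMr// mul1r ler_nat ltnW.
    have SA' : S < b0 + i%:R * (C * `|h| + A * h ^+ 2) + A.
      by have := mulr_ge0 i0 cont; lra.
    have := lipschitz_step C0 ihL (IHi (ltnW iN)) (le_trans ler01 A1) SA'.
    move=> /(_ s (c + i.+1%:R * h)).
    have -> : c + i.+1%:R * h - (c + i%:R * h) = h by rewrite -natr1; ring.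
    move=> /(_ h1) /le_trans; apply.
    by rewrite -natr1 le_eqVlt; apply/orP; left; apply/eqP; ring.
  have := step n.+1 (leqnn _) t; rewrite -/N.
  have -> : c + N * h = x by rewrite /h /y; field; rewrite gt_eqF.
  move=> /le_trans; apply; rewrite normrM normfV (gtr0_norm N0).
  rewrite le_eqVlt; apply/orP; left; apply/eqP; rewrite /h; field.
  by rewrite gt_eqF.
apply/ler_addgt0Pr => e e0; rewrite -/y.
have [n nb] : exists n : nat, `|y| + A * y ^+ 2 / e <= n.+1%:R.
  exists (Num.truncn (`|y| + A * y ^+ 2 / e)); exact/ltW/truncnS_gt.
have Ay0 : 0 <= A * y ^+ 2 by rewrite mulr_ge0 ?sqr_ge0//; lra.
have Aye : 0 <= A * y ^+ 2 / e by rewrite divr_ge0// ltW.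
apply: le_trans (main n (le_trans _ nb)) _; first by lra.
rewrite lerD2l ler_pdivrMr ?ltr0n// -ler_pdivrMl// mulrC.
by have := normr_ge0 y; lra.
Qed.

End Lipschitz.

(** Maximise [U - kappa (x - c0)^2] over the strip of half-width [L]. Since [kappa * L = C + 1]
    exceeds the Lipschitz constant [C], the maximum is interior. Its slope [2 kappa (c - c0)] is
    then bounded by [C] through coercivity, so [c] is so close to [c0] that the window of radius
    [1 / kappa] about [c] stays in the strip. *)
Lemma parabola_touching (kappa : R) : 0 < C -> 0 < kappa ->
  (forall L, exists c : R, forall t x a b : R, `|x - c| < L -> superjet U t x a b ->
     a + G t x b <= lam) ->
  exists q c t1 : R, [/\ `|q| <= C,
    forall t x : R, `|x - c| <= kappa^-1 ->
      U (t, x) <= U (t1, c) + q * (x - c) + kappa * (x - c) ^+ 2 &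
    forall t x a b : R, `|x - c| <= kappa^-1 -> superjet U t x a b ->
      a + G t x b <= lam].
Proof.
move=> C0 k0 subfar; pose L := (C + 1) / kappa.
have kL : kappa * L = C + 1 by rewrite /L mulrCA mulfV ?mulr1// gt_eqF.
have L0 : 0 < L by rewrite divr_gt0//; lra.
have ki0 : 0 < kappa^-1 by rewrite invr_gt0.
have [c0 sub] := subfar (L + 1).
have cst0 : continuous (fun _ : R => 0 : R) by move=> ?; exact: cvg_cst.
(* A strip of zero width: this maximises over time alone, at [x = c0]. *)
have [s0 [z0 [z0c]]] := strip_max c0 cst0 (lexx 0).
rewrite normr_le0 subr_eq0 in z0c; move/eqP: z0c => -> {z0} Uc.
have [s1 [z1 [_ US]]] := strip_max c0 cst0 (ltW (ltr_pwDr ltr01 (ltW L0))).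
have lip (t x : R) : `|x - c0| <= L -> U (t, x) <= U (s0, c0) + C * `|x - c0|.
  apply: (@lipschitz_bound c0 L (U (s1, z1))) => //.
  - by move=> s z /(US s); rewrite !subr0.
  - by move=> s; have := Uc s c0; rewrite subrr normr0 !subr0; apply.
have cpsi : continuous (fun x : R => kappa * (x - c0) ^+ 2).
  move=> x; apply: cvgMr.
  have cB : (z - c0) @[z --> x] --> x - c0.
    by apply: cvgB; [exact: cvg_id|exact: cvg_cst].
  by rewrite expr2; apply: cvgM.
have [t1 [c [cL cmax]]] := strip_max c0 cpsi (ltW L0).
pose d : R := `|c - c0|.
have d2 : (c - c0) ^+ 2 = d ^+ 2 by rewrite /d real_normK ?num_real.
have dL : d < L.
  rewrite lt_neqAle cL andbT; apply/eqP => e.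
  have := lip t1 c cL; have := cmax s0 c0; rewrite subrr normr0 => /(_ (ltW L0)).
  rewrite d2 -/d e expr0n /= mulr0 subr0 expr2 mulrA kL => h1 h2.
  suff : L < 0 by rewrite ltNge ltW.
  nra.
have par (t x : R) : `|x - c0| <= L ->
    U (t, x) <= U (t1, c) + 2 * kappa * (c - c0) * (x - c) + kappa * (x - c) ^+ 2.
  move=> /(cmax t x); have -> : x - c0 = (x - c) + (c - c0) by ring.
  by move=> h; rewrite -subr_ge0; move: h; rewrite -subr_ge0; congr (0 <= _); ring.
have qC : `|2 * kappa * (c - c0)| <= C.
  rewrite leNgt; apply/negP => /ltW /Gcoer big.
  have : 0 + G t1 c (2 * kappa * (c - c0)) <= lam.
    apply: sub; first by rewrite -/d; lra.
    exists 0, kappa, (L - d); split; first by lra.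
    move=> t x xr; rewrite /quad /= !mul0r !addr0; apply: par.
    by have := ler_distD c x c0; rewrite -/d; lra.
  by rewrite add0r leNgt big.
have near x : `|x - c| <= kappa^-1 -> `|x - c0| <= L.
  move=> xc; have := ler_distD c x c0; rewrite -/d.
  suff : kappa * d <= kappa * (L - kappa^-1) by rewrite ler_pM2l//; lra.
  rewrite mulrBr kL mulfV ?gt_eqF//.
  by move: qC; rewrite !normrM -/d !gtr0_norm//; have := normr_ge0 (c - c0); rewrite -/d; nra.
exists (2 * kappa * (c - c0)), c, t1; split=> //.
  by move=> t x /near; exact: par.
by move=> t x a b /near xL; apply: sub; lra.
Qed.

End Strip.

(** * Doubling of variables *)

(** Concavity of [ln]: its tangent at [1 + A * n]. With squares for [m] and [n] it bounds the time
    penalisation by a parabola touching it, as a superjet requires. *)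
Lemma ln_quadratic (R : realType) (A m n : R) : 0 <= A -> 0 <= m -> 0 <= n ->
  ln (1 + A * m) <= ln (1 + A * n) + A / (1 + A * n) * (m - n).
Proof.
move=> A0 m0 n0.
have Am : 0 < 1 + A * m by rewrite ltr_pwDl// mulr_ge0.
have An : 0 < 1 + A * n by rewrite ltr_pwDl// mulr_ge0.
rewrite -lerBlDl -ln_div//.
have -> : (1 + A * m) / (1 + A * n) = 1 + A / (1 + A * n) * (m - n).
  by field; lra.
apply: le_ln1Dx; rewrite -subr_gt0.
have -> : A / (1 + A * n) * (m - n) - -1 = (1 + A * m) / (1 + A * n) by field; lra.
exact: divr_gt0.
Qed.

Lemma closer_translate (R : realType) (t s : R) :
  exists k : int, `|t - (s + k%:~R)| <= 1 /\ `|t - (s + k%:~R)| <= `|t - s|.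
Proof.
have [ts|/ltW ts] := leP `|t - s| 1; first by exists 0; rewrite addr0.
have [k k0 k1] := periodic_unit (s - t); exists k.
have -> : t - (s + k%:~R) = - (s - t + k%:~R) by ring.
by rewrite normrN ger0_norm//; split=> //; exact: le_trans ts.
Qed.

Section Doubling.
Variables (R : realType) (U W : R * R -> R) (D : R).
Hypotheses (uscU : usc U) (uscW : usc W).
Hypotheses (perU : forall t x : R, U (t + 1, x) = U (t, x))
  (perWt : forall t x : R, W (t + 1, x) = W (t, x))
  (perWx : forall t x : R, W (t, x + 1) = W (t, x))
  (WD : forall z, `|W z| <= D).

(** Periodicity supplies the compactness: [(t, s)] is shifted jointly until [t] lies in [0, 1], and
    [s], [y] are replaced by integer translates within distance 1 of [t], [x], which does not
    increase [theta] or [chi]. Only [x] must be confined, since [psi] is not periodic. *)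
Lemma doubling_max (psi theta chi : R -> R) (c r : R) : 0 <= r ->
  continuous psi -> continuous theta -> continuous chi ->
  (forall m n : R, `|m| <= `|n| -> theta m <= theta n) ->
  (forall m n : R, `|m| <= `|n| -> chi m <= chi n) ->
  exists t x s y : R, `|x - c| <= r /\ forall t' x' s' y' : R, `|x' - c| <= r ->
    U (t', x') + W (s', y') - psi x' - theta (t' - s') - chi (x' - y') <=
    U (t, x) + W (s, y) - psi x - theta (t - s) - chi (x - y).
Proof.
move=> r0 cpsi cth cchi mth mchi.
pose F (z : (R * R) * (R * R)) : R := U z.1 + W z.2 +
  (- psi z.1.2 - theta (z.1.1 - z.2.1) - chi (z.1.2 - z.2.2)).
have uscF : usc F.
  have c11 : continuous (fun z : (R * R) * (R * R) => z.1.1).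
    by move=> z; apply: (cvg_comp _ _ cvg_fst); exact: cvg_fst.
  have c12 : continuous (fun z : (R * R) * (R * R) => z.1.2).
    by move=> z; apply: (cvg_comp _ _ cvg_fst); exact: cvg_snd.
  have c21 : continuous (fun z : (R * R) * (R * R) => z.2.1).
    by move=> z; apply: (cvg_comp _ _ cvg_snd); exact: cvg_fst.
  have c22 : continuous (fun z : (R * R) * (R * R) => z.2.2).
    by move=> z; apply: (cvg_comp _ _ cvg_snd); exact: cvg_snd.
  apply: uscD.
    apply: uscD.
      by apply: (usc_comp uscU) => z; exact: cvg_fst.
    by apply: (usc_comp uscW) => z; exact: cvg_snd.
  apply: continuous_usc => z; apply: cvgB; first apply: cvgB.
  - by apply: cvgN; apply: (cvg_comp _ _ (c12 z)); exact: cpsi.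
  - have cB : (y.1.1 - y.2.1) @[y --> z] --> z.1.1 - z.2.1.
      by apply: cvgB; [exact: c11|exact: c21].
    exact: (cvg_comp _ _ cB (cth _)).
  - have cB : (y.1.2 - y.2.2) @[y --> z] --> z.1.2 - z.2.2.
      by apply: cvgB; [exact: c12|exact: c22].
    exact: (cvg_comp _ _ cB (cchi _)).
pose K1 : set (R * R) := `[0, 1] `*` `[c - r, c + r].
pose K2 : set (R * R) := `[-1, 2] `*` `[c - r - 1, c + r + 1].
have cK : compact (K1 `*` K2).
  by apply: compact_setX; apply: compact_setX; exact: segment_compact.
have K0 : K1 `*` K2 !=set0.
  by exists ((0, c), (0, c)); split; split; rewrite /= in_itv /=; lra.
have [[[t x] [s y]] [[/= _ xr] _] maxF] := usc_max cK K0 uscF.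
exists t, x, s, y; split; first by rewrite distrC ler_distlC; rewrite in_itv in xr.
move=> t' x' s' y' xr'.
have [k [k1 kle]] := closer_translate t' s'.
have [l [l1 lle]] := closer_translate x' y'.
have [j j0 j1] := periodic_unit t'.
have := maxF ((t' + j%:~R, x'), (s' + k%:~R + j%:~R, y' + l%:~R)).
rewrite /F /= (periodic_int (f := fun t => U (t, x')))//.
rewrite (periodic_int (f := fun x => W (_, x)))//.
rewrite !(periodic_int (f := fun t => W (t, y')))//.
have -> : t' + j%:~R - (s' + k%:~R + j%:~R) = t' - (s' + k%:~R) by ring.
have := mth _ _ kle; have := mchi _ _ lle.
move: xr' k1 l1; rewrite !ler_norml => /andP[xr1 xr2] /andP[k1 k2] /andP[l1 l2].
move=> h1 h2 h3.
suff : U (t', x') + W (s', y') +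
    (- psi x' - theta (t' - (s' + k%:~R)) - chi (x' - (y' + l%:~R))) <=
    U (t, x) + W (s, y) + (- psi x - theta (t - s) - chi (x - y)) by lra.
by apply: h3; do 2 split; rewrite /= in_itv /=; lra.
Qed.

(** [psi] carries [2 * kappa], twice the curvature of the touching parabola. Comparing the maximum
    with the value at [(t1, c, t1, c)] therefore bounds the two penalties and a spare
    [kappa (x - c)^2] together by [2 * D], which also keeps [x] off the boundary of the window. *)
Lemma doubling (eta A B kappa q c t1 r : R) :
  0 < eta -> 0 <= A -> 0 <= B -> 0 < kappa -> 0 < r -> 2 * D < kappa * r ^+ 2 ->
  (forall t x : R, `|x - c| <= r ->
    U (t, x) <= U (t1, c) + q * (x - c) + kappa * (x - c) ^+ 2) ->
  exists t x s y : R, let k := eta * (A / (1 + A * (t - s) ^+ 2)) in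
    [/\ `|x - c| < r, eta * ln (1 + A * (t - s) ^+ 2) <= 2 * D,
      B * (x - y) ^+ 2 <= 2 * D,
      superjet U t x (2 * k * (t - s)) (q + 4 * kappa * (x - c) + 2 * B * (x - y)) &
      superjet W s y (- (2 * k * (t - s))) (- (2 * B * (x - y)))].
Proof.
move=> eta0 A0 B0 k0 r0 kr par.
pose psi (x : R) : R := q * (x - c) + 2 * kappa * (x - c) ^+ 2.
pose theta (m : R) : R := eta * ln (1 + A * m ^+ 2).
pose chi (m : R) : R := B * m ^+ 2.
have A1 (m : R) : 0 < 1 + A * m ^+ 2 by rewrite ltr_pwDl// mulr_ge0// sqr_ge0.
have csq : continuous (fun m : R => m ^+ 2) by move=> m; exact: exprn_continuous.
have cpsi : continuous psi.
  move=> x; have cB : (z - c) @[z --> x] --> x - c.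
    by apply: cvgB; [exact: cvg_id|exact: cvg_cst].
  apply: cvgD; apply: cvgMr => //.
  exact: (cvg_comp _ _ cB (csq _)).
have cth : continuous theta.
  move=> m; apply: cvgMr.
  have cA : (1 + A * z ^+ 2) @[z --> m] --> 1 + A * m ^+ 2.
    by apply: cvgD; [exact: cvg_cst|apply: cvgMr; exact: csq].
  exact: (cvg_comp _ _ cA (continuous_ln (A1 m))).
have cchi : continuous chi by move=> m; apply: cvgMr; exact: csq.
have sqle (m n : R) : `|m| <= `|n| -> m ^+ 2 <= n ^+ 2.
  by move=> mn; rewrite -(real_normK (num_real m)) -(real_normK (num_real n)) lerXn2r ?nnegrE.
have mth (m n : R) : `|m| <= `|n| -> theta m <= theta n.
  move=> /sqle mn; rewrite /theta ler_pM2l// ler_ln ?posrE// lerD2l.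
  exact: ler_wpM2l.
have mchi (m n : R) : `|m| <= `|n| -> chi m <= chi n.
  by move=> /sqle mn; exact: ler_wpM2l.
have [t [x [s [y [xr maxF]]]]] := doubling_max c (ltW r0) cpsi cth cchi mth mchi.
exists t, x, s, y => k.
have theta0 : 0 <= theta (t - s).
  by rewrite mulr_ge0 ?(ltW eta0)// ln_ge0// lerDl mulr_ge0// sqr_ge0.
have chi0 : 0 <= chi (x - y) by rewrite mulr_ge0// sqr_ge0.
have kx0 : 0 <= kappa * (x - c) ^+ 2 by rewrite mulr_ge0 ?sqr_ge0// ltW.
have sum : theta (t - s) + chi (x - y) + kappa * (x - c) ^+ 2 <= 2 * D.
  have := maxF t1 c t1 c; rewrite subrr normr0 => /(_ (ltW r0)).
  have := par t x xr; have := ler_norm (W (s, y)); have := WD (s, y).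
  have := ler_norm (- W (t1, c)); rewrite normrN; have := WD (t1, c).
  rewrite /psi subrr !subrr /theta /chi expr0n /= !mulr0 !addr0 ln1 !mulr0.
  rewrite -/(theta (t - s)) -/(chi (x - y)); lra.
have thetale (m : R) : theta m <= theta (t - s) + k * (m ^+ 2 - (t - s) ^+ 2).
  have := ln_quadratic A0 (sqr_ge0 m) (sqr_ge0 (t - s)).
  rewrite -(ler_pM2l eta0) mulrDr => /le_trans; apply.
  by rewrite /k -[in leRHS]mulrA.
have xr' : `|x - c| < r.
  rewrite ltNge; apply/negP => rx; suff : r < r by rewrite ltxx.
  suff : kappa * r ^+ 2 <= kappa * (x - c) ^+ 2 by lra.
  by rewrite ler_wpM2l ?(ltW k0)// sqle// gtr0_norm.
split=> //.
- by rewrite -/(theta (t - s)); lra.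
- by rewrite -/(chi (x - y)); lra.
- exists k, (2 * kappa + B), (r - `|x - c|); split; first by lra.
  move=> t' x' x'r; have xr'' : `|x' - c| <= r by have := ler_distD x x' c; lra.
  have := maxF t' x' s y xr''; have := thetale (t' - s).
  rewrite /quad /= /psi /chi => h1 h2.
  have e1 : (t' - s) ^+ 2 - (t - s) ^+ 2 = 2 * (t - s) * (t' - t) + (t' - t) ^+ 2.
    by ring.
  rewrite e1 in h1; nra.
- exists k, B, 1; split=> // s' y' _.
  have := maxF t x s' y' xr; have := thetale (t - s').
  rewrite /quad /= /chi => h1 h2.
  have e1 : (t - s') ^+ 2 - (t - s) ^+ 2 = - (2 * (t - s) * (s' - s)) + (s' - s) ^+ 2.
    by ring.
  rewrite e1 in h1; nra.
Qed.

End Doubling.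

(** * Comparison of a sub-solution with correctors for a limit Hamiltonian *)

Definition coercive (R : realType) (G : R -> R -> R -> R) : Prop :=
  forall M, exists K, forall t x q : R, K <= `|q| -> M <= G t x q.

Definition space_continuous (R : realType) (G : R -> R -> R -> R) : Prop :=
  forall Q e, 0 < e -> exists2 nu, 0 < nu & forall t x y p q : R,
    `|x - y| <= nu -> `|p - q| <= nu -> `|q| <= Q -> `|G t x p - G t y q| < e.

(** The form of (A2) that survives passing to the limit Hamiltonians. *)
Definition time_continuous (R : realType) (G : R -> R -> R -> R) : Prop :=
  forall e, 0 < e -> exists2 d, 0 < d & forall t s x p : R,
    `|t - s| * (1 + Num.max (G s x p) 0) < d -> G t x p - G s x p <= e.

Section Comparison.
Variables (R : realType) (G : R -> R -> R -> R) (U : R * R -> R) (lam : R).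
Hypotheses (uscU : usc U) (perU : forall t x : R, U (t + 1, x) = U (t, x)).
Hypotheses (Gc : coercive G) (Gs : space_continuous G) (Gt : time_continuous G).

Definition touched_at (kappa q c t1 : R) : Prop := forall t x : R,
  `|x - c| <= kappa^-1 ->
  U (t, x) <= U (t1, c) + q * (x - c) + kappa * (x - c) ^+ 2 /\
  forall a b : R, superjet U t x a b -> a + G t x b <= lam.

(** All constants are fixed before [kappa], so [nu] and [kappa0] are the same for all slopes near
    [p]; this uniformity feeds the compactness argument of [comparison]. *)
Lemma no_gap (W : R * R -> R) (D p Lam : R) :
  usc W -> (forall t x : R, W (t + 1, x) = W (t, x)) ->
  (forall t x : R, W (t, x + 1) = W (t, x)) -> (forall z, `|W z| <= D) ->
  (forall t x a b : R, superjet W t x a b -> Lam <= - a + G t x (p - b)) ->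
  lam < Lam ->
  exists nu kappa0 : R, [/\ 0 < nu, 0 < kappa0 & forall kappa q c t1 : R,
    0 < kappa -> kappa < kappa0 -> `|q - p| < nu -> ~ touched_at kappa q c t1].
Proof.
move=> uscW perWt perWx WD Wjet gap.
have D0 : 0 <= D by apply: le_trans (WD (0, 0)).
(* Moving from [(s, y, P)] to [(t, y, P)] and then to [(t, x, P')] costs at most [e] each time,
   while the gap is [4 * e]. *)
pose e := (Lam - lam) / 4; have e0 : 0 < e by rewrite /e; lra.
have [d d0 Gtd] := Gt e0.
(* This gives [|sig| * |tau| <= d / 4]; [A] below makes [|sig| * C <= d / 2]. Their sum stays under
   [d]. *)
pose eta := d / 8; have eta0 : 0 < eta by rewrite /eta; lra.
pose C := 1 + `|lam| + e; have C1 : 1 <= C by rewrite /C; have := normr_ge0 lam; lra.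
pose X := expR (2 * D / eta); have X0 : 0 < X by exact: expR_gt0.
pose A := X * (2 * C / d) ^+ 2 + 1.
have A1 : 1 <= A by rewrite lerDr mulr_ge0 ?sqr_ge0// ltW.
(* Since [|tau| <= eta * A], the sub-solution inequality forces [|P'| <= K]. *)
have [K GK] := Gc (lam + eta * A + 1).
have [nu1 nu10 Gnu] := Gs K e0.
pose B := (2 * D + 1) / nu1 ^+ 2.
have B0 : 0 < B by rewrite divr_gt0 ?exprn_gt0//; lra.
(* [P - P'] consists of [p - q], below [nu], and [4 * kappa * (x - c)], at most [4 * nu]. The bound
   1 places the radius [nu / kappa] within [1 / kappa]. *)
pose nu := Num.min 1 (nu1 / 5).
have nu0 : 0 < nu by rewrite lt_min ltr01 divr_gt0.
have nu1' : nu <= 1 by rewrite ge_min lexx.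
have nu5 : 5 * nu <= nu1 by have : nu <= nu1 / 5 by [rewrite ge_min lexx orbT]; lra.
exists nu, (nu ^+ 2 / (2 * D + 1)); split=> //.
  by rewrite divr_gt0 ?exprn_gt0//; lra.
move=> kappa q c t1 k0 kk0 qp touch.
pose r := nu / kappa; have r0 : 0 < r by rewrite divr_gt0.
have kr : kappa * r = nu by rewrite /r mulrCA mulfV ?mulr1// gt_eqF.
have rk : r <= kappa^-1 by rewrite /r ler_piMl// invr_ge0 ltW.
have kr2 : 2 * D < kappa * r ^+ 2.
  have -> : kappa * r ^+ 2 = nu ^+ 2 / kappa by rewrite /r; field; lra.
  rewrite ltr_pdivlMr//.
  move: kk0; rewrite ltr_pdivlMr; last by lra.
  by rewrite mulrDr mulr1 mulrC; lra.
have par (t x : R) : `|x - c| <= r ->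
    U (t, x) <= U (t1, c) + q * (x - c) + kappa * (x - c) ^+ 2.
  by move=> xr; have [] := touch t x (le_trans xr rk).
have [t [x [s [y [xc lnD BD Ujet Wj]]]]] := doubling uscU uscW perU perWt perWx
  WD eta0 (le_trans ler01 A1) (ltW B0) k0 r0 kr2 par.
have {Ujet} subU := (touch t x (le_trans (ltW xc) rk)).2 _ _ Ujet.
have {Wj} supW := Wjet _ _ _ _ Wj.
rewrite !opprK in supW.
set sig := t - s in lnD subU supW.
set den := 1 + A * sig ^+ 2 in lnD subU supW.
have sig2 : 0 <= sig ^+ 2 by exact: sqr_ge0.
have den1 : 1 + sig ^+ 2 <= den by rewrite lerD2l ler_peMl.
have den0 : 0 < den by lra.
set k := eta * (A / den) in subU supW.
have k_ge0 : 0 <= k by rewrite mulr_ge0 ?divr_ge0//; lra.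
have kden : k * den = eta * A by rewrite /k -mulrA divfK// gt_eqF.
clearbody k.
set tau := 2 * k * sig in subU supW.
have tausig : `|sig| * `|tau| <= 2 * eta.
  have -> : `|sig| * `|tau| = 2 * (k * sig ^+ 2).
    rewrite -normrM -[RHS]ger0_norm; last by rewrite mulr_ge0// mulr_ge0.
    by congr `|_|; rewrite /tau; ring.
  rewrite ler_pM2l// -(ler_pM2r den0) mulrAC kden -mulrA ler_pM2l//.
  by rewrite /den; lra.
have tauA : `|tau| <= eta * A.
  have -> : `|tau| = k * (2 * `|sig|).
    by rewrite /tau !normrM (ger0_norm k_ge0) gtr0_norm//; ring.
  rewrite -kden ler_wpM2l//; apply: le_trans den1.
  by have := sqr_ge0 (`|sig| - 1); rewrite sqrrB1 real_normK ?num_real//; lra.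
have sigC : `|sig| * C <= d / 2.
  have AX : A * sig ^+ 2 <= X.
    have : ln den <= 2 * D / eta by rewrite ler_pdivlMr// mulrC.
    rewrite -ler_expR lnK ?posrE// -/X /den; lra.
  have le1 : (2 * C / d * `|sig|) ^+ 2 <= 1.
    rewrite -(ler_pM2l X0) exprMn real_normK ?num_real// mulrA mulr1.
    by apply: le_trans AX; rewrite ler_wpM2r// /A lerDl.
  have : 2 * C / d * `|sig| <= 1.
    rewrite -(@ler_pXn2r _ 2)// ?expr1n ?nnegrE//.
    by rewrite mulr_ge0// divr_ge0//; lra.
  have -> : 2 * C / d * `|sig| = (2 * (`|sig| * C)) / d by field; lra.
  by rewrite ler_pdivrMr// mul1r; lra.
have xy : `|x - y| <= nu1.
  rewrite -(@ler_pXn2r _ 2)// ?nnegrE ?(ltW nu10)// real_normK ?num_real//.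
  rewrite -(ler_pM2l B0); apply: le_trans BD _.
  by rewrite /B divfK ?gt_eqF ?exprn_gt0//; lra.
pose P := p + 2 * B * (x - y).
pose P' := q + 4 * kappa * (x - c) + 2 * B * (x - y).
have PP' : `|P - P'| <= nu1.
  have -> : P - P' = (p - q) - 4 * (kappa * (x - c)) by rewrite /P /P'; ring.
  have := ler_normB (p - q) (4 * (kappa * (x - c))).
  rewrite (distrC p) (normrM 4) (gtr0_norm (x := 4))// normrM (gtr0_norm k0).
  have : kappa * `|x - c| <= nu by rewrite -kr ler_pM2l// ltW.
  lra.
have tau1 := ler_norm tau; have tau2 := ler_norm (- tau); rewrite normrN in tau2.
have P'K : `|P'| <= K.
  rewrite leNgt; apply/negP => /ltW /(GK t x) GP'.
  suff : lam < lam by rewrite ltxx.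
  by move: subU GP'; rewrite -/P' => subU GP'; lra.
have yx : `|y - x| <= nu1 by rewrite distrC.
have := Gnu t y x P P' yx PP' P'K; rewrite ltr_norml => /andP[_ space].
have time : G s y P - G t y P <= e.
  apply: Gtd; rewrite distrC -/sig.
  have maxC : 1 + Num.max (G t y P) 0 <= C + `|tau|.
    rewrite -lerBrDl ge_max; apply/andP; split; last first.
      by rewrite /C; have := normr_ge0 lam; have := normr_ge0 tau; lra.
    by have := ler_norm lam; move: subU; rewrite -/P' /C => subU; lra.
  apply: le_lt_trans (ler_wpM2l (normr_ge0 sig) maxC) _.
  by rewrite mulrDr; move: tausig sigC; rewrite /eta; lra.
suff : e < e by rewrite ltxx.
move: subU supW; rewrite -/P' -/P => subU supW.
by move: time space; rewrite /e; lra.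
Qed.

(** Each slope [p] in [[-C, C]] is excluded, with its neighbours, for all small [kappa].
    Compactness, in covering form with [kappa] as filter index, gives one [kappa] excluding all of
    them, against [parabola_touching]. *)
Lemma comparison :
  (forall L, exists c : R, forall t x a b : R, `|x - c| < L ->
     superjet U t x a b -> a + G t x b <= lam) ->
  (forall p, exists W D Lam, [/\ usc W,
     forall t x : R, W (t + 1, x) = W (t, x) /\ W (t, x + 1) = W (t, x),
     forall z : R * R, `|W z| <= D,
     forall t x a b : R, superjet W t x a b -> Lam <= - a + G t x (p - b) &
     lam < Lam]) ->
  False.
Proof.
move=> subfar super.
have [C0 GC0] := Gc (lam + 1); pose C := `|C0| + 1.
have C_gt0 : 0 < C by rewrite /C; have := normr_ge0 C0; lra.
have GC (t x q : R) : C <= `|q| -> lam < G t x q.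
  move=> Cq; have : lam + 1 <= G t x q; last by lra.
  by apply: GC0; have := ler_norm C0; move: Cq; rewrite /C; lra.
have : \forall kappa \near 0^'+, `[-C, C] `<=` (fun q => forall c t1 : R,
    ~ touched_at kappa q c t1).
  have /compact_near_coveringP := @segment_compact R (-C) C.
  apply => p _.
  have [W [D [Lam [uW pW WD Wj gap]]]] := super p.
  have [nu [k0 [nu0 k00 ng]]] := no_gap uW (fun t x => (pW t x).1)
    (fun t x => (pW t x).2) WD Wj gap.
  exists ([set q | `|p - q| < nu], [set kappa | 0 < kappa < k0]) => /=.
    split; first by exists nu.
    near=> kappa; apply/andP; split; near: kappa; [exact: nbhs_right_gt|exact: nbhs_right_lt].
  case=> q kappa /= [qp /andP[ka0 kak0]] c t1.
  by apply: ng => //; rewrite distrC.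
move=> near0.
have [kappa kap0 nokap] : exists2 kappa : R, 0 < kappa &
    `[-C, C] `<=` (fun q => forall c t1 : R, ~ touched_at kappa q c t1).
  near (0 : R)^'+ => kappa; exists kappa => //.
  by near: kappa.
have [q [c [t1 [qC par jet]]]] := parabola_touching uscU perU GC C_gt0 kap0 subfar.
apply: (nokap q _ c t1); first by rewrite /= in_itv /= -ler_norml.
by move=> t x xk; split; [exact: par|move=> a b; exact: jet].
Unshelve. all: by end_near. Qed.

End Comparison.

(** * Periodic limits at infinity *)

Lemma uniform_continuous_compact (R : realType) (f : R * R * R -> R)
    (K : set (R * R * R)) e : continuous f -> compact K -> 0 < e ->
  exists2 nu, 0 < nu & forall z z', K z -> ball z nu z' -> `|f z - f z'| < e.
Proof.
move=> cf /compact_near_coveringP cK e0.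
have near0 : \forall nu \near (0 : R)^'+, K `<=`
    (fun z => forall z', ball z nu z' -> `|f z - f z'| < e).
  apply: cK => z _.
  have /cvgrPdist_lt/(_ (e / 2)) := cf z.
  have e2 : 0 < e / 2 by lra.
  move=> /(_ e2)/nbhs_ballP[rho /= rho0 zrho].
  have rho2 : 0 < rho / 2 by rewrite divr_gt0.
  exists (ball z (rho / 2), [set nu | nu < rho / 2]) => /=.
    by split; [exact: nbhsx_ballx|exact: nbhs_right_lt].
  case=> z1 nu /= [zz1 nurho] z' z1z'.
  have f1 : `|f z - f z1| < e / 2 by apply: zrho; apply: le_ball zz1; lra.
  have f2 : `|f z - f z'| < e / 2.
    apply: zrho; rewrite [rho]splitr; apply: ball_triangle zz1 _.
    by apply: le_ball z1z'; exact: ltW.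
  rewrite distrC in f1.
  by have := ler_distD (f z) (f z1) (f z'); lra.
near (0 : R)^'+ => nu; exists nu => //.
by move=> z z' Kz; have : K `<=` (fun z => forall z', ball z nu z' ->
  `|f z - f z'| < e) by [near: nu]; exact.
Unshelve. all: by end_near. Qed.

Section Hamiltonian.
Variables (R : realType) (H : R -> R -> R -> R).
Hypotheses (hA0 : A0 H) (hA1 : A1 H) (hA2 : A2 H) (hA3 : A3 H).

Lemma hamiltonian_bounded (X Q : R) : exists M : R, forall t x p : R,
  `|x| <= X -> `|p| <= Q -> `|H t x p| <= M.
Proof.
pose K : set (R * R * R) := (`[0, 1] `*` `[- X, X]) `*` `[- Q, Q].
have cK : compact K.
  by do 2 (try apply: compact_setX); exact: segment_compact.
have uH : usc (fun y : R * R * R => `|H y.1.1 y.1.2 y.2|).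
  by apply: continuous_usc => y; apply: cvg_norm; exact: hA0.
have [K0|K0] := pselect (K !=set0); last first.
  exists 0 => t x p xX pQ; exfalso; apply: K0; exists ((0, x), p).
  by do 2 ?split; rewrite /= in_itv /= ?lexx ?ler01// -ler_norml.
have [z _ maxz] := usc_max cK K0 uH.
exists (`|H z.1.1 z.1.2 z.2|) => t x p xX pQ.
have [k k0 k1] := periodic_unit t; rewrite -(hA1 k).
apply: (maxz ((t + k%:~R, x), p)).
by do 2 ?split; rewrite /= in_itv /= ?k0// -ler_norml.
Qed.

Section Limit.
Variable G : R -> R -> R -> R.
Hypotheses (perG : forall (k j : int) (t x p : R),
    G (t + k%:~R) (x + j%:~R) p = G t x p)
  (HG : forall e L : R, 0 < e -> exists c : R, forall t x p : R,
    `|x - c| < L -> `|H t x p - G t x p| < e).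

(** One integer vector carries a whole neighbourhood of [x] into the window where [H] is close to
    [G]. Estimates on [H] over a bounded set of [x] thus become estimates on [G] over the whole
    plane. *)
Lemma limit_translate (e L : R) : 0 < e -> exists c : R, forall t x : R,
  exists k j : int, [/\ 0 <= t + k%:~R <= 1, `|x + j%:~R - c| <= 1 &
    forall s y p : R, `|y - x| < L ->
      G s y p = G (s + k%:~R) (y + j%:~R) p /\
      `|H (s + k%:~R) (y + j%:~R) p - G s y p| < e].
Proof.
move=> e0; have [c HGc] := HG (L + 1) e0; exists c => t x.
have [k k0 k1] := periodic_unit t; have [j j0 j1] := periodic_unit (x - c).
have xj : x + j%:~R - c = x - c + j%:~R by ring.
exists k, j; split; first by rewrite k0.
  by rewrite xj ger0_norm.
move=> s y p yx; split; first by rewrite perG.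
rewrite -(perG k j); apply: HGc.
have -> : y + j%:~R - c = (y - x) + (x + j%:~R - c) by ring.
apply: le_lt_trans (ler_normD _ _) _; rewrite xj (ger0_norm j0); lra.
Qed.

Lemma limit_bounded (Q : R) : exists M : R, forall t x p : R,
  `|p| <= Q -> `|G t x p| <= M.
Proof.
have [c tr] := limit_translate 1 ltr01.
have [M HM] := hamiltonian_bounded (`|c| + 1) Q.
exists (M + 1) => t x p pQ; have [k [j [_ xj close]]] := tr t x.
have [|_ {}close] := close t x p; first by rewrite subrr normr0.
have xX : `|x + j%:~R| <= `|c| + 1.
  by have := ler_normD (x + j%:~R - c) c; rewrite subrK; lra.
have := HM (t + k%:~R) _ p xX pQ.
have := ler_normB (H (t + k%:~R) (x + j%:~R) p)
  (H (t + k%:~R) (x + j%:~R) p - G t x p).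
by rewrite opprB addrC subrK; lra.
Qed.

Lemma limit_coercive : coercive G.
Proof.
move=> M; have [K HK] := hA3 (M + 1); exists K => t x q /HK Hq.
have [c /(_ t x)[k [j [_ _ close]]]] := limit_translate 1 ltr01.
have [|_] := close t x q; first by rewrite subrr normr0.
by rewrite ltr_norml => /andP[_]; have := Hq (t + k%:~R) (x + j%:~R); lra.
Qed.

Lemma limit_space_continuous : space_continuous G.
Proof.
move=> Q e e0; have e3 : 0 < e / 3 by lra.
have [c tr] := limit_translate 2 e3.
pose K : set (R * R * R) := (`[0, 1] `*` `[c - 1, c + 1]) `*` `[- Q, Q].
have cK : compact K.
  by do 2 (try apply: compact_setX); exact: segment_compact.
have [nu nu0 unif] := uniform_continuous_compact hA0 cK e3.
exists (Num.min 1 (nu / 2)); first by rewrite lt_min ltr01 divr_gt0.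
move=> t x y p q; rewrite !le_min => /andP[xy1 xy2] /andP[_ pq2] qQ.
have [k [j [tk yj close]]] := tr t y.
have [|_ cx] := close t x p; first by apply: le_lt_trans xy1 _; lra.
have [|_ cy] := close t y q; first by rewrite subrr normr0.
have := unif ((t + k%:~R, y + j%:~R), q) ((t + k%:~R, x + j%:~R), p).
have nu2 : nu / 2 < nu by lra.
move=> /= /(_ _ _)/wrap[].
  by do 2 ?split; rewrite /= in_itv //= -?ler_distlC 1?distrC// -ler_norml.
  split; first split => /=; first exact: ballxx.
    by rewrite /ball /= opprD addrACA subrr addr0 distrC; exact: le_lt_trans nu2.
  by rewrite /ball /= distrC; exact: le_lt_trans nu2.
rewrite distrC => h; rewrite distrC in cx.
have := ler_distD (H (t + k%:~R) (x + j%:~R) p) (G t x p) (G t y q).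
have := ler_distD (H (t + k%:~R) (y + j%:~R) q)
  (H (t + k%:~R) (x + j%:~R) p) (G t y q).
lra.
Qed.

Lemma limit_time_continuous : time_continuous G.
Proof.
move=> e e0; have [omega [om0 om_homo om_lim] hom] := hA2.
(* Two replacements of [G] by [H] cost [e / 2] in all and the modulus another [e / 2]. The bound 1
   gives [H <= G + 1], which at most doubles the weight in (A2), whence the radius [r / 2]. *)
pose e' := Num.min (e / 4) 1.
have e'0 : 0 < e' by rewrite lt_min ltr01 andbT; lra.
have [e'4 e'1] : e' <= e / 4 /\ e' <= 1 by rewrite !ge_min !lexx orbT.
have [r r0 omr] : exists2 r, 0 < r & omega r < e / 2.
  have /cvgrPdist_lt/(_ (e / 2)) := om_lim.
  have e2 : 0 < e / 2 by lra.
  move=> /(_ e2) near0; near (0 : R)^'+ => r; exists r => //.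
  have : `|0 - omega r| < e / 2 by near: r.
  by rewrite sub0r normrN; exact/le_lt_trans/ler_norm.
exists (r / 2); first by rewrite divr_gt0.
move=> t s x p lt_r.
have [c /(_ 0 x)[k [j [_ _ close]]]] := limit_translate 1 e'0.
have xx : `|x - x| < 1 by rewrite subrr normr0.
have [_ ct] := close t x p xx; have [_ cs] := close s x p xx.
have := hom (t + k%:~R) (s + k%:~R) (x + j%:~R) p.
have -> : t + k%:~R - (s + k%:~R) = t - s by ring.
set m := `|t - s| * _ => hle.
have mr : m <= r.
  have : m <= `|t - s| * (2 * (1 + Num.max (G s x p) 0)).
    rewrite ler_wpM2l// -lerBrDl ge_max; apply/andP; split.
      have : G s x p <= Num.max (G s x p) 0 by rewrite le_max lexx.
      have : 0 <= Num.max (G s x p) 0 by rewrite le_max lexx orbT.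
      by move: cs; rewrite ltr_norml => /andP[_]; lra.
    have : 0 <= Num.max (G s x p) 0 by rewrite le_max lexx orbT.
    lra.
  by rewrite mulrCA; lra.
have m0 : 0 <= m.
  by rewrite mulr_ge0// addr_ge0// le_max lexx orbT.
have := om_homo _ _ m0 mr.
move: ct cs; rewrite !ltr_norml => /andP[? ?] /andP[? ?]; lra.
Unshelve. all: by end_near. Qed.

End Limit.
End Hamiltonian.

Section EndLimits.
Variables (R : realType) (H HL HR : R -> R -> R -> R).
Hypotheses (hA1 : A1 H) (hA5 : A5 H HL HR).

Lemma near_limit (G : R -> R -> R -> R) (k : int) (e : R) :
  (forall (k j : int) t x p, G (t + k%:~R) (x + j%:~R) p = G t x p) ->
  (forall t x p, 0 <= t <= 1 -> 0 <= x <= 1 ->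
    `|H t (x + k%:~R) p - G t x p| < e) ->
  forall t x p : R, k%:~R <= x <= k%:~R + 1 -> `|H t x p - G t x p| < e.
Proof.
move=> perG close t x p /andP[kx xk]; have [l l0 l1] := periodic_unit t.
rewrite -(hA1 l) -[G t x p](perG l (- k)).
have -> : H (t + l%:~R) x p = H (t + l%:~R) (x + (- k)%:~R + k%:~R) p.
  by congr (H _ _ p); rewrite mulrNz subrK.
by apply: close; rewrite ?l0// mulrNz; apply/andP; split; lra.
Qed.

Lemma right_limit (e : R) : 0 < e -> exists X : R, forall t x p : R,
  X <= x -> `|H t x p - HR t x p| < e.
Proof.
case: hA5 => _ hR _ perR /hR[K hK]; exists K%:~R => t x p Kx.
apply: (near_limit perR (hK (Num.floor x) _)); first by rewrite floor_ge_int.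
by rewrite ge_floor; have /ltW := floorD1_gt x; rewrite intrD.
Qed.

Lemma left_limit (e : R) : 0 < e -> exists X : R, forall t x p : R,
  x <= X -> `|H t x p - HL t x p| < e.
Proof.
case: hA5 => hL _ perL _ /hL[K hK]; exists K%:~R => t x p Kx.
apply: (near_limit perL (hK (Num.floor x) _)); first last.
  by rewrite ge_floor; have /ltW := floorD1_gt x; rewrite intrD.
by rewrite -(ler_int R); apply: le_trans Kx; exact: ge_floor.
Qed.

(** The common shape in which both ends enter the limit arguments. *)
Lemma right_windows (e L : R) : 0 < e -> exists c : R, forall t x p : R,
  `|x - c| < L -> `|H t x p - HR t x p| < e.
Proof.
move=> /right_limit[X hX]; exists (X + L) => t x p.
by rewrite ltr_norml => /andP[? ?]; apply: hX; lra.
Qed.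

Lemma left_windows (e L : R) : 0 < e -> exists c : R, forall t x p : R,
  `|x - c| < L -> `|H t x p - HL t x p| < e.
Proof.
move=> /left_limit[X hX]; exists (X - L) => t x p.
by rewrite ltr_norml => /andP[? ?]; apply: hX; lra.
Qed.

End EndLimits.

(** * Constant sub-solutions *)

(** Right difference quotients at a minimum are nonnegative in every direction; apply this to [v]
    and [- v]. *)
Lemma derive_locmin (R : realType) (phi : R * R -> R) (z v : R * R) :
  differentiable phi z -> (\forall y \near z, phi z <= phi y) ->
  'D_v phi z = 0.
Proof.
move=> dphi zmin.
have ge0 (w : R * R) : 0 <= 'D_w phi z.
  have /cvg_ex[l dl] := diff_derivable (v := w) dphi.
  have -> : 'D_w phi z = l by exact: cvg_lim.
  have dl0 : h^-1 *: (phi (h *: w + z) - phi z) @[h --> 0^'+] --> l.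
    apply: cvg_trans dl; apply: cvg_app; apply: within_subset => h /=.
    by rewrite lt_neqAle eq_sym => /andP[].
  have cz : (h *: w + z) @[h --> 0^'+] --> z.
    have cz0 : (h *: w + z) @[h --> 0^'+] --> (0 : R) *: w + z.
      apply: cvgD; last exact: cvg_cst.
      by apply: cvgZl; apply: cvg_at_right_filter; exact: cvg_id.
    by rewrite scale0r add0r in cz0.
  apply: (cvgr_to_ge dl0); near=> h.
  have h0 : 0 < h by near: h; exact: nbhs_right_gt.
  apply: mulr_ge0; first by rewrite invr_ge0 ltW.
  rewrite subr_ge0.
  by near: h; exact: (cz _ zmin).
apply/eqP; rewrite eq_le ge0 andbT -oppr_ge0.
have -> : - 'D_v phi z = 'D_(- v) phi z by rewrite !deriveE// linearN.
exact: ge0.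
Unshelve. all: by end_near. Qed.

Lemma cst_subsolution (R : realType) (H : R -> R -> R -> R) (M : R) :
  (forall t x, H t x 0 <= M) -> subsolution H M (fun=> 0).
Proof.
move=> HM; split=> [z|phi z [dphi _ _] [tch near_le]].
  exact: (cvg_bounded _ _ (cvg_cst (0 : R))).
rewrite usc_env_cst in tch; case: tch => phiz.
have zmin : \forall y \near z, phi z <= phi y.
  by apply: filterS near_le => y; rewrite usc_env_cst lee_fin phiz.
by rewrite /dt /dx !derive_locmin// add0r HM.
Qed.

(** * Lower bound for [E_set] from one end *)

Section FluxLimiter.
Variables (R : realType) (H G : R -> R -> R -> R) (Gbar : R -> R).
Hypotheses (hA0 : A0 H) (hA1 : A1 H) (hA2 : A2 H) (hA3 : A3 H).
Hypotheses (perG : forall (k j : int) (t x p : R),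
    G (t + k%:~R) (x + j%:~R) p = G t x p)
  (HG : forall e L : R, 0 < e -> exists c : R, forall t x p : R,
    `|x - c| < L -> `|H t x p - G t x p| < e)
  (hG : homogenized G Gbar).

Lemma limit_lbound : exists m : R, forall t x p : R, m <= G t x p.
Proof.
have [K GK] := limit_coercive hA3 perG HG 0.
have [M GM] := limit_bounded hA0 hA1 perG HG K.
exists (- `|M|) => t x p; have [/(GK t x) Gp|pK] := leP K `|p|.
  by apply: le_trans Gp; rewrite oppr_le0.
have := GM t x p (ltW pK); have := ler_norm M.
by have := ler_norm (- G t x p); rewrite normrN; lra.
Qed.

Lemma periodic_t_env (u : R * R -> R) : locally_bounded u -> periodic_t u ->
  forall t x : R, env u (t + 1, x) = env u (t, x).
Proof.
move=> ub ut t x; rewrite -[in RHS](env_shift (h := (1, 0)) ub).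
  by congr (env u (_, _)); rewrite /= addr0.
by move=> [s y]; rewrite -[RHS]ut; congr (u (_, _)); rewrite /= addr0.
Qed.

Lemma periodic_x_env (u : R * R -> R) : locally_bounded u ->
  (forall t x, u (t, x + 1) = u (t, x)) ->
  forall t x : R, env u (t, x + 1) = env u (t, x).
Proof.
move=> ub ux t x; rewrite -[in RHS](env_shift (h := (0, 1)) ub).
  by congr (env u (_, _)); rewrite /= addr0.
by move=> [s y]; rewrite -[RHS]ux; congr (u (_, _)); rewrite /= addr0.
Qed.

Lemma periodic_tx1 (v : R * R -> R) : periodic_tx v ->
  periodic_t v /\ forall t x, v (t, x + 1) = v (t, x).
Proof.
move=> pv; split=> t x; first by have := pv 1 0 t x; rewrite addr0.
by have := pv 0 1 t x; rewrite addr0.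
Qed.

(** Makes [inf (range Gbar)] a genuine infimum. The envelope of a periodic corrector attains its
    maximum, where a constant touches it, so [Gbar p] is at least a value of [G]. *)
Lemma homogenized_lbound : has_lbound (range Gbar).
Proof.
have [m Gm] := limit_lbound; exists m => _ [p _ <-].
have [[v [_ pv [sub _]]] _] := hG p.
have [vb _] := sub; have [pt px] := periodic_tx1 pv.
have ut := periodic_t_env vb pt; have ux := periodic_x_env vb px.
have cst0 : continuous (fun _ : R => 0 : R) by move=> ?; exact: cvg_cst.
have [t1 [x1 [_ maxu]]] := strip_max (env_usc vb) ut 0 cst0 ler01.
apply: le_trans (Gm t1 x1 (p + 0)) _.
rewrite -[leLHS]add0r; apply: (subsolution_superjet sub).
exists 0, 0, 1; split=> // t x _; rewrite /quad !mul0r !addr0.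
have [k k0 k1] := periodic_unit x.
have := maxu t (x + k%:~R); rewrite !subr0 ger0_norm// => /(_ k1).
by rewrite (periodic_int (f := fun x => env v (_, x))).
Qed.

Lemma flux_limiter_le lam : E_set H lam -> inf (range Gbar) <= lam.
Proof.
move=> [w [sub wt]]; have [wb _] := sub; rewrite leNgt; apply/negP => lt.
(* Half of the gap pays for replacing [H] by [G]; the other half keeps [lam + e] strictly below
   every [Gbar p]. *)
pose e := (inf (range Gbar) - lam) / 2; have e0 : 0 < e by rewrite /e; lra.
apply: (@comparison _ G (env w) (lam + e)).
- exact: env_usc.
- exact: periodic_t_env.
- exact: (limit_coercive hA3 perG HG).
- exact: (limit_space_continuous hA0 perG HG).
- exact: (limit_time_continuous hA2 perG HG).
- move=> L; have [c HGc] := HG L e0; exists c => t x a b xL.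
  move=> /(subsolution_superjet sub).
  by have := HGc t x b xL; rewrite ltr_norml => /andP[? _]; lra.
move=> p; have [[v [/pinfty_ex_gt0[M _ vM] pv [[vb _] super]]] _] := hG p.
have [pt px] := periodic_tx1 pv.
have Nvb := locally_boundedN vb.
exists (env (fun z => - v z)), M, (Gbar p); split.
- exact: env_usc.
- move=> t x; split.
    by apply: periodic_t_env => // s y; rewrite pt.
  by apply: periodic_x_env => // s y; rewrite px.
- move=> z; have {}vM y : `|v y| <= M by exact: vM.
  rewrite ler_norml; apply/andP; split.
    apply: le_trans (le_env z Nvb); rewrite lerN2.
    exact: le_trans (ler_norm _) (vM z).
  apply: env_le => // y; apply: le_trans (vM y).
  by rewrite -normrN ler_norm.
- by move=> t x a b /(supersolution_superjet super).
have : inf (range Gbar) <= Gbar p.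
  by apply: (ge_inf homogenized_lbound); exists p.
by rewrite /e; lra.
Qed.

End FluxLimiter.

Theorem theorem1p4 (R : realType) (H HL HR : R -> R -> R -> R)
    (HbarL HbarR : R -> R)
    (hA0 : A0 H) (hA1 : A1 H) (hA2 : A2 H) (hA3 : A3 H) (hA4 : A4 H)
    (hA5 : A5 H HL HR)
    (hB : (Bi HL /\ Bi HR) \/ (Bii HL /\ Bii HR))
    (hL : homogenized HL HbarL) (hR : homogenized HR HbarR) :
  [/\ E_set H !=set0,
      has_lbound (E_set H) &
      lower_flux_limiter HbarL HbarR <= inf (E_set H)].
Proof.
have [_ _ perL perR] := hA5.
have WL e L (e0 : 0 < e) := left_windows hA1 hA5 L e0.
have WR e L (e0 : 0 < e) := right_windows hA1 hA5 L e0.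
(* The zero function works at any level above all [H t x 0]: the periodic limits bound these near
   both ends, compactness in between. *)
have E0 : E_set H !=set0.
  have [XR hXR] := right_limit hA1 hA5 ltr01.
  have [XL hXL] := left_limit hA1 hA5 ltr01.
  have [MR hMR] := limit_bounded hA0 hA1 perR WR 0.
  have [ML hML] := limit_bounded hA0 hA1 perL WL 0.
  have [M hM] := hamiltonian_bounded hA0 hA1 (`|XL| + `|XR|) 0.
  pose N := `|M| + `|ML| + `|MR| + 1.
  have [M0 ML0 MR0] := And3 (normr_ge0 M) (normr_ge0 ML) (normr_ge0 MR).
  have [M1 ML1 MR1] := And3 (ler_norm M) (ler_norm ML) (ler_norm MR).
  have n0 : `|0 : R| <= 0 by rewrite normr0.
  exists N, (fun=> 0); split=> //; apply: cst_subsolution => t x.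
  have [/(hXR t x 0)|xR] := leP XR x.
    have := hMR t x 0 n0; have := ler_norm (HR t x 0).
    by rewrite ltr_norml /N => ? ? /andP[_ ?]; lra.
  have [/(hXL t x 0)|Lx] := leP x XL.
    have := hML t x 0 n0; have := ler_norm (HL t x 0).
    by rewrite ltr_norml /N => ? ? /andP[_ ?]; lra.
  have xX : `|x| <= `|XL| + `|XR|.
    have := ler_norm XR; have := ler_norm (- XL); rewrite normrN ler_norml.
    have := normr_ge0 XL; have := normr_ge0 XR => *; apply/andP; split; lra.
  by have := hM t x 0 xX n0; have := ler_norm (H t x 0); rewrite /N; lra.
have Elb : lbound (E_set H) (lower_flux_limiter HbarL HbarR).
  move=> lam Elam; rewrite /lower_flux_limiter ge_max.
  rewrite (flux_limiter_le hA0 hA1 hA2 hA3 perL WL hL Elam).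
  by rewrite (flux_limiter_le hA0 hA1 hA2 hA3 perR WR hR Elam).
split=> //; first by exists (lower_flux_limiter HbarL HbarR).
exact: lb_le_inf.
Qed.
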